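(* Let $n,b,c,d,e$ be nonnegative integers. Then \[\sum_{k=0}^n \binom{n}{k}^2\frac{\binom{k+bn}{k}\binom{k+cn}{k}\binom{k+dn}{k}\binom{n+en}{k}}{\binom{n+bn}{k}\binom{n+cn}{k}\binom{n+dn}{k}\binom{k+en}{k}}\Big\{1+(n-2k)\big(2H_k-H_{bn+k}-H_{cn+k}-H_{dn+k}+H_{en+k}\big)\Big\}\] \[= \frac{\binom{1+bn+dn+n}{n}}{\binom{n+bn}{n}\binom{n+dn}{n}}\sum_{\ell=0}^n(-1)^\ell\binom{n}{\ell}\frac{\binom{\ell+bn}{\ell}\binom{\ell+dn}{\ell}\binom{cn-en}{\ell}}{\binom{n+cn}{\ell}\binom{\ell+en}{\ell}\binom{1+bn+dn+\ell}{\ell}}.\]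
   Context: $H_0=0$ and $H_m=\sum_{j=1}^m \frac{1}{j}$ for positive integers $m$. For an integer $m$ (possibly negative) and a nonnegative integer $j$, $\binom{m}{j}=\frac{m(m-1)\cdots(m-j+1)}{j!}$. *)

(* Defs.v *)
From mathcomp Require Import all_boot all_order all_algebra.

Set Implicit Arguments.
Unset Strict Implicit.
Unset Printing Implicit Defensive.

Import Order.TTheory GRing.Theory Num.Theory.
Local Open Scope ring_scope.

Definition harmonic (m : nat) : rat := \sum_(1 <= j < m.+1) j%:R^-1.

(* m (m - 1) ... (m - j + 1) / j!, for an integer m of any sign. *)
Definition binz (m : int) (j : nat) : rat :=
  (\prod_(i < j) (m%:~R - i%:R)) / (j`!)%:R.

(* binz extends the library's binomial coefficient, so the latter can be used
   whenever the upper argument is a natural number. *)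
Lemma binz_nat (m j : nat) : binz m%:Z j = 'C(m, j)%:R.
Proof.
rewrite /binz.
have -> : \prod_(i < j) ((m%:Z)%:~R - i%:R) = (m ^_ j)%:R :> rat.
  elim: j => [|j IHj]; first by rewrite big_ord0 ffactn0.
  rewrite big_ord_recr /= IHj ffactnSr natrM.
  have [le_jm | lt_mj] := leqP j m; first by rewrite natrB.
  by rewrite ffact_small // !mul0r.
by rewrite -bin_ffact natrM mulfK // pnatr_eq0 -lt0n fact_gt0.
Qed.

(* Main.v *)
(* Let [y = z (n - z)], [B = b n], ..., [E = e n]. The [k]-th hypergeometric
   factor of the left-hand side is [f(k)] with
   [f = beta_B beta_C beta_D / beta_E], where [beta_B], a product of factors
   [(y + j (n + j)) / (j (n + j))], is symmetric under [z <-> n - z].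
   If [h_k] is the combination of harmonic numbers next to [n - 2k], then
   [f'(k) / f(k) = h_(n-k) - h_k], so reversing the sum turns the left-hand
   side into [sum_k ((z - n/2) f)'(k)].
   To first order at [0, ..., n], [beta_C / beta_E] is a combination of the
   Newton polynomials [w_l = prod_(i < l) (y - i (n - i))], [l <= n], because
   [w_(n+1)] has double zeros there. Finally the sum of derivatives for
   [f = w_l beta_B beta_D] has a closed form: for [B = D = 0] it telescopes,
   and [B], [D] are raised by the same recurrence
   [(y + m (n + m)) w_l = w_(l+1) + (l + m) (n - l + m) w_l] which gives the
   Newton coefficients. *)
Require Import Defs.
From mathcomp Require Import all_boot all_order all_algebra.
From mathcomp Require Import ring.

Import Order.TTheory GRing.Theory Num.Theory.
Local Open Scope ring_scope.

(** * Newton polynomials, beta factors and first-order jets at the nodes 0, ..., n *)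

Definition newton (n l : nat) : {poly rat} :=
  \prod_(i < l) (('X - i%:R) * (n%:R - i%:R - 'X)).

Definition beta (n B : nat) : {poly rat} :=
  \prod_(j < B) ((j.+1%:R * (n%:R + j.+1%:R))^-1
                   *: (('X + j.+1%:R) * (n%:R + j.+1%:R - 'X))).

(** This is congruence modulo the square of [\prod_(k < n.+1) ('X - k%:R)], in the pointwise form in
    which it is used. *)
Definition eqjet (n : nat) (p q : {poly rat}) : Prop :=
  forall k : nat, (k <= n)%N ->
    p.[k%:R] = q.[k%:R] /\ p^`().[k%:R] = q^`().[k%:R].

Definition dsum (n : nat) (p : {poly rat}) : rat :=
  \sum_(0 <= k < n.+1) (('X - (n%:R / 2)%:P) * p)^`().[k%:R].

Lemma newtonS n l :
  newton n l.+1 = newton n l * (('X - l%:R) * (n%:R - l%:R - 'X)).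
Proof. by rewrite /newton big_ord_recr /=. Qed.

Lemma betaS n B :
  beta n B.+1 = (B.+1%:R * (n%:R + B.+1%:R))^-1
                  *: (beta n B * (('X + B.+1%:R) * (n%:R + B.+1%:R - 'X))).
Proof. by rewrite /beta big_ord_recr /= -scalerAr. Qed.

(** With y = z (n - z), the new factor is y + m (n + m) and the next factor of [newton] is y - l (n
    - l); they differ by m (n + m) + l (n - l) = (l + m) (n - l + m). *)
Lemma newton_shift n l m :
  newton n l * (('X + m%:R) * (n%:R + m%:R - 'X))
  = newton n l.+1 + ((l%:R + m%:R) * (n%:R - l%:R + m%:R)) *: newton n l.
Proof. 
rewrite newtonS -mul_polyC !(rmorphM, rmorphD, rmorphB, rmorph_nat) /=; ring.
Qed.

Lemma eqjetM n p q r : eqjet n p q -> eqjet n (r * p) (r * q).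
Proof.
move=> pq k /pq[pq0 pq1].
by rewrite !derivM !hornerD !hornerM pq0 pq1.
Qed.

Lemma eqjetZ n a p q : eqjet n p q -> eqjet n (a *: p) (a *: q).
Proof. by rewrite -!mul_polyC; apply: eqjetM. Qed.

Lemma eqjetD n p q p' q' :
  eqjet n p q -> eqjet n p' q' -> eqjet n (p + p') (q + q').
Proof.
move=> pq pq' k lekn; have [a b] := pq k lekn; have [a' b'] := pq' k lekn.
by rewrite !derivD !hornerD a b a' b'.
Qed.

Lemma eqjet_refl n p : eqjet n p p.
Proof. by []. Qed.

Lemma eqjet_trans n p q r : eqjet n p q -> eqjet n q r -> eqjet n p r.
Proof.
move=> pq qr k lekn; have [a b] := pq k lekn; have [a' b'] := qr k lekn.
by rewrite a b.
Qed.

Lemma eqjet_sym n p q : eqjet n p q -> eqjet n q p.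
Proof. by move=> pq k /pq[-> ->]. Qed.

Lemma newton_split n l :
  newton n l = (\prod_(i < l) ('X - i%:R)) * \prod_(i < l) (n%:R - i%:R - 'X).
Proof. by rewrite /newton big_split. Qed.

(** Each of the two products of linear factors vanishes at every node, so both terms of the product
    rule vanish too. *)
Lemma newton_eqjet0 n : eqjet n (newton n n.+1) 0.
Proof.
move=> k lekn; rewrite newton_split deriv0 !horner0 derivM hornerD !hornerM.
have -> : (\prod_(i < n.+1) ('X - i%:R : {poly rat})).[k%:R] = 0.
  rewrite horner_prod (bigD1 (Ordinal (lekn : (k < n.+1)%N))) //=.
  by rewrite !hornerE hornerMn !hornerE subrr mul0r.
have -> : (\prod_(i < n.+1) (n%:R - i%:R - 'X : {poly rat})).[k%:R] = 0.
  have lt : (n - k < n.+1)%N by rewrite ltnS leq_subr.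
  rewrite horner_prod (bigD1 (Ordinal lt)) //=.
  rewrite natrB // !hornerE !hornerMn !hornerE; ring.
by rewrite !(mulr0, mul0r, addr0).
Qed.

Lemma dsumD n p q : dsum n (p + q) = dsum n p + dsum n q.
Proof.
rewrite /dsum -big_split; apply: eq_bigr => k _ /=.
by rewrite mulrDr derivD hornerD.
Qed.

Lemma dsumZ n a p : dsum n (a *: p) = a * dsum n p.
Proof.
rewrite /dsum mulr_sumr; apply: eq_bigr => k _ /=.
by rewrite -scalerAr derivZ hornerZ.
Qed.

Lemma dsum_sum n m (F : nat -> {poly rat}) :
  dsum n (\sum_(0 <= l < m) F l) = \sum_(0 <= l < m) dsum n (F l).
Proof.
elim: m => [|m IHm]; last by rewrite !big_nat_recr //= dsumD IHm.
by rewrite !big_geq // -(scale0r 0) dsumZ mul0r.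
Qed.

(** * Recurrences for binomial coefficients in the rationals *)

Lemma natr_binSr m p :
  'C(m + p.+1, m)%:R = (m + p).+1%:R * 'C(m + p, m)%:R / p.+1%:R :> rat.
Proof.
apply: canRL (mulfK _) _; first by rewrite pnatr_eq0.
rewrite -!natrM mulnC; congr _%:R.
have := mul_bin_down (m + p.+1) m.
by rewrite addnS subSn ?leq_addr // addKn /= => ->.
Qed.

Lemma natr_binSl m p :
  'C(m.+1 + p, m.+1)%:R = (m + p).+1%:R * 'C(m + p, m)%:R / m.+1%:R :> rat.
Proof.
apply: canRL (mulfK _) _; first by rewrite pnatr_eq0.
by rewrite -!natrM mulnC addSn -mul_bin_diag.
Qed.

Lemma natr_binS m p :
  'C(m, p.+1)%:R = (m%:R - p%:R) * 'C(m, p)%:R / p.+1%:R :> rat.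
Proof.
apply: canRL (mulfK _) _; first by rewrite pnatr_eq0.
have [le_pm | lt_mp] := leqP p m.
  by rewrite -natrB // -!natrM mulnC mul_bin_left.
by rewrite !bin_small ?(leqW lt_mp) // mulr0 mul0r.
Qed.

Lemma natr_bin_neq0 m p : 'C(m + p, m)%:R != 0 :> rat.
Proof. by rewrite pnatr_eq0 -lt0n bin_gt0 leq_addr. Qed.

Lemma natrDS_neq0 (n l : nat) : n%:R + l.+1%:R != 0 :> rat.
Proof. by rewrite -natrD addnS pnatr_eq0. Qed.

(** * Values and derivatives of the beta factors at the nodes *)

(** The quotients (k + j) / j multiply to ['C(k + B, k)], the quotients (n - k + j) / (n + j) to
    ['C(n, k) / 'C(n + B, k)]. Three such values divided by a fourth leave the square of
    ['C(n, k)]. *)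
Lemma beta_horner n B k : (k <= n)%N ->
  (beta n B).[k%:R]
  = 'C(k + B, k)%:R * 'C(n, k)%:R / 'C(n + B, k)%:R.
Proof.
move=> /subnKC <-; set m := (n - k)%N; elim: B => [|B IHB].
  rewrite /beta big_ord0 hornerE !addn0 binn mul1r divff //.
  exact: natr_bin_neq0.
rewrite betaS hornerZ hornerM IHB !(hornerE, hornerMn).
rewrite natr_binSr -!addnA addnS [X in _ = _ / X]natr_binSr.
have h1 := natr_bin_neq0 k (m + B); have h2 := natrDS_neq0 0 B.
have h3 := natrDS_neq0 (k + m) B; have h4 := natrDS_neq0 m B.
rewrite add0r -!natr1 !natrD -?natr1 ?addrA in h2 h3 h4 *.
by rewrite /=; field; rewrite h1 h2 h3 h4.
Qed.

Lemma harmonicS m : harmonic m.+1 = harmonic m + m.+1%:R^-1.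
Proof. by rewrite /harmonic big_nat_recr. Qed.

(** The logarithmic derivative is the sum over 1 <= j <= B of 1 / (k + j) - 1 / (n - k + j). *)
Lemma beta_deriv n B k : (k <= n)%N ->
  (beta n B)^`().[k%:R] = (beta n B).[k%:R]
    * (harmonic (B + k) - harmonic k
       - harmonic (B + (n - k)) + harmonic (n - k)).
Proof.
move=> lekn; elim: B => [|B IHB].
  rewrite /beta big_ord0 derivC hornerE !add0n; ring.
rewrite betaS derivZ !hornerZ derivM hornerD !hornerM IHB.
rewrite !(derivE, hornerE, hornerMn) !addSn !harmonicS.
have -> : (B + k).+1%:R = k%:R + B.+1%:R :> rat by rewrite -natrD addnS addnC.
have -> : (B + (n - k)).+1%:R = n%:R + B.+1%:R - k%:R :> rat.
  by rewrite -addSn natrD natrB //; ring.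
have k0 : (k%:R + B.+1%:R != 0 :> rat) by rewrite -natrD addnS pnatr_eq0.
have n0 : (n%:R + B.+1%:R != 0 :> rat) by rewrite -natrD addnS pnatr_eq0.
have B0 : (B.+1%:R != 0 :> rat) by rewrite pnatr_eq0.
have nk0 : (n%:R + B.+1%:R - k%:R != 0 :> rat).
  rewrite -natrD -natrB; last by apply: leq_trans (leq_addr _ _).
  by rewrite pnatr_eq0 -lt0n subn_gt0 addnS ltnS (leq_trans lekn) ?leq_addr.
rewrite -!natr1 ?addrA in k0 n0 B0 nk0 * => /=.
by field; rewrite n0 nk0 B0 k0.
Qed.


(** * Sum of derivatives of a Newton polynomial, by telescoping *)

Lemma newton_recl n l :
  newton n.+1 l.+1 = newton n l * (('X - l%:R) * (n%:R + 1 - 'X)).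
Proof.
elim: l => [|l IHl]; last by rewrite newtonS IHl newtonS; ring.
by rewrite newtonS /newton !big_ord0; ring.
Qed.

Lemma newton_recl_comp n l :
  newton n.+1 l.+1 \Po ('X + 1) = newton n l * (('X + 1) * (n%:R - l%:R - 'X)).
Proof.
have compE k m (p : {poly rat}) :
  (p * (('X - k%:R) * (m%:R - k%:R - 'X))) \Po ('X + 1)
  = (p \Po ('X + 1)) * (('X + 1 - k%:R) * (m%:R - k%:R - ('X + 1))).
  by rewrite !(rmorphM, rmorphB, rmorph_nat) /= comp_polyX.
elim: l => [|l IHl]; last by rewrite newtonS compE IHl newtonS; ring.
by rewrite newtonS compE /newton !big_ord0 rmorph1; ring.
Qed.

(** With the zeros at 0 and n + 1 split off, the derivative at these points is read off from the
    value of the remaining product. *)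
Lemma newton_factor n l :
  newton n.+1 l.+1
  = 'X * (n%:R + 1 - 'X) * \prod_(i < l) (('X - i.+1%:R) * (n%:R - i%:R - 'X)).
Proof.
rewrite /newton big_ord_recl /= subr0; congr (_ * _).
  by rewrite subr0 -natr1.
apply: eq_bigr => i _; rewrite /bump /= -!natr1; ring.
Qed.

(** Let W be [newton n.+1 l.+1]. Both W(z) and W(z + 1) are [newton n l] times a quadratic, and the
    quadratics differ by a multiple of z - n/2. Hence the sum telescopes to a multiple of W'(n + 1)
    - W'(0). *)
Lemma dsum_newton n l :
  dsum n (newton n l)
  = (-1) ^+ l * l`!%:R ^+ 2 * 'C(n, l)%:R * n.+1%:R / l.+1%:R.
Proof.
set r := (-1) ^+ l * l`!%:R ^+ 2 * 'C(n, l)%:R.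
set R : {poly rat} := \prod_(i < l) (('X - i.+1%:R) * (n%:R - i%:R - 'X)).
(* [r] is the value of the cofactor [R] at both ends 0 and n + 1. *)
have prodE : \prod_(i < l) (- i.+1%:R * (n%:R - i%:R)) = r :> rat.
  rewrite /r; elim: (l) => [|m IHm].
    by rewrite big_ord0 fact0 bin0 expr0 expr1n !mulr1.
  rewrite big_ord_recr /= IHm natr_binS factS natrM [(-1) ^+ m.+1]exprS.
  have := natrDS_neq0 0 m; rewrite -!natr1 add0r => h; by field.
move: r prodE => r prodE.
have R0 : R.[0] = r.
  rewrite -prodE horner_prod; apply: eq_bigr => i _.
  by rewrite !(hornerE, hornerMn); ring.
have Rn : R.[n.+1%:R] = r.
  rewrite -prodE horner_prod; apply: eq_bigr => i _.
  by rewrite !(hornerE, hornerMn) -!natr1; ring.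
set W := newton n.+1 l.+1.
have W'0 : W^`().[0] = n.+1%:R * r.
   by rewrite /W newton_factor -/R !(derivE, hornerE, hornerMn) R0 -natr1 /=;
    ring.
have W'n : W^`().[n.+1%:R] = - (n.+1%:R * r).
  by rewrite /W newton_factor -/R !(derivE, hornerE, hornerMn) Rn -natr1; ring.
have WE : ('X - (n%:R / 2)%:P) * newton n l
   = (- (2 * l.+1%:R)^-1) *: (W \Po ('X + 1) - W).
  rewrite newton_recl_comp /W newton_recl.
  have -> : newton n l * (('X + 1) * (n%:R - l%:R - 'X))
            - newton n l * (('X - l%:R) * (n%:R + 1 - 'X))
          = - (2 * l.+1%:R) *: (('X - (n%:R / 2)%:P) * newton n l).
    have <- : 2 * (n%:R / 2)%:P = n%:R :> {poly rat}.
      by rewrite -(rmorph_nat polyC 2) -polyCM mulrC mulfVK // rmorph_nat.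
    by rewrite -mul_polyC !(rmorphN, rmorphM, rmorph_nat) /= -natr1; ring.
  rewrite scalerA mulrNN mulVf ?scale1r //.
  by rewrite mulf_neq0 // pnatr_eq0.
rewrite /dsum WE.
under eq_bigr => k _.
  rewrite derivZ hornerZ derivB deriv_comp hornerD hornerN hornerM horner_comp.
  rewrite !(derivE, hornerE) natr1; over.
rewrite -mulr_sumr telescope_sumr // W'n W'0.
by field; rewrite addrC natr1 pnatr_eq0.
Qed.

(** * Closed form of the sum of derivatives with two beta factors *)

(** Multiplied by [ncoef n C E l], this is the l-th term of the right-hand side; the squared
    factorial cancels there. *)
Definition dsum_value (n B D l : nat) : rat :=
  (-1) ^+ l * l`!%:R ^+ 2 * 'C(n, l)%:R * ('C(l + B, l)%:R * 'C(l + D, l)%:R)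
  * 'C(n + (B + D).+1, n)%:R
  / ('C(n + B, n)%:R * 'C(n + D, n)%:R * 'C(l + (B + D).+1, l)%:R).

Lemma dsum_valueC n B D l : dsum_value n B D l = dsum_value n D B l.
Proof.
rewrite /dsum_value (addnC B D).
by rewrite [X in _ * X * _ / _]mulrC [X in _ / (X * _)]mulrC.
Qed.

Lemma dsum_valueS n B D l :
  B.+1%:R * (n%:R + B.+1%:R) * dsum_value n B.+1 D l
  = dsum_value n B D l.+1
    + (l%:R + B.+1%:R) * (n%:R - l%:R + B.+1%:R) * dsum_value n B D l.
Proof.
rewrite /dsum_value factS natrM [(-1) ^+ l.+1]exprS natr_binS !natr_binSl addSn.
rewrite (natr_binSr l B) (natr_binSr n B) (natr_binSr n (B + D).+1).
rewrite (natr_binSr l (B + D).+1) !addnS.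
have h1 := natr_bin_neq0 n B; have h2 := natr_bin_neq0 n D.
have h3 := natr_bin_neq0 l (B + D).+1; rewrite addnS in h3.
have p m : m.+1%:R != 0 :> rat by rewrite pnatr_eq0.
have h4 := p l; have h5 := p B; have h6 := p (B + D).+1.
have h7 := p (n + B)%N; have h8 := p (l + (B + D)).+1.
rewrite -!natr1 !natrD ?addrA in h4 h5 h6 h7 h8 *.
by field; rewrite h1 h2 h3 h4 h5 h6 h7 h8.
Qed.

Lemma dsum_value00 n l : dsum_value n 0 0 l = dsum n (newton n l).
Proof.
by rewrite dsum_newton /dsum_value !addn0 !binn !addn1 !binSn !mul1r mulr1.

Qed.

(** The last factor of [beta n B.+1] is absorbed into the Newton polynomial by [newton_shift]. The
    arbitrary [p] carries the other beta factor, so one recurrence serves for both parameters. *)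
Lemma dsum_newton_betaS n B l p :
  B.+1%:R * (n%:R + B.+1%:R) * dsum n (newton n l * (beta n B.+1 * p))
  = dsum n (newton n l.+1 * (beta n B * p))
    + (l%:R + B.+1%:R) * (n%:R - l%:R + B.+1%:R)
      * dsum n (newton n l * (beta n B * p)).
Proof.
rewrite -!dsumZ -dsumD; congr dsum.
rewrite betaS -scalerAl -scalerAr scalerA mulfV; last first.
  by rewrite -natrD addnS mulf_neq0 // pnatr_eq0.
rewrite scale1r.
have -> : newton n l * (beta n B * (('X + B.+1%:R) * (n%:R + B.+1%:R - 'X)) * p)
  = (newton n l * (('X + B.+1%:R) * (n%:R + B.+1%:R - 'X))) * (beta n B * p).
  by ring.
by rewrite newton_shift mulrDl -scalerAl.
Qed.

Lemma dsum_newton_beta n B D l :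
  dsum n (newton n l * (beta n B * beta n D)) = dsum_value n B D l.
Proof.
have nz m : m.+1%:R * (n%:R + m.+1%:R) != 0 :> rat.
  by rewrite -natrD addnS mulf_neq0 // pnatr_eq0.
(* [l] stays general because the recurrence calls on l + 1. *)
elim: B l => [|B IHB] l.
  elim: D l => [|D IHD] l.
    by rewrite dsum_value00 /beta !big_ord0 !mulr1.
  apply: (mulfI (nz D)); rewrite [beta n 0 * _]mulrC dsum_newton_betaS.
  by rewrite [beta n D * _]mulrC !IHD !(dsum_valueC _ 0) dsum_valueS.
by apply: (mulfI (nz B)); rewrite dsum_newton_betaS !IHB dsum_valueS.
Qed.

(** * Newton expansion of a quotient of beta factors *)

Definition newton_sum (n : nat) (a : nat -> rat) : {poly rat} :=
  \sum_(0 <= l < n.+1) a l *: newton n l.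

Lemma newton_sum_shift n m a :
  eqjet n (newton_sum n a * (('X + m%:R) * (n%:R + m%:R - 'X)))
    (newton_sum n (fun l => (if l is l'.+1 then a l' else 0)
                            + (l%:R + m%:R) * (n%:R - l%:R + m%:R) * a l)).
Proof.
set b := (X in eqjet _ _ (newton_sum n X)).
set q := _ * (_ - 'X).
(* Only the top term l = n leaves the range; it yields [newton n n.+1], whose jets vanish. *)
have -> : newton_sum n a * q = newton_sum n b + a n *: newton n n.+1.
  have -> : newton_sum n a * q = \sum_(0 <= l < n.+1) a l *: newton n l.+1
     + \sum_(0 <= l < n.+1)
         ((l%:R + m%:R) * (n%:R - l%:R + m%:R) * a l) *: newton n l.
    rewrite mulr_suml -big_split; apply: eq_bigr => l _ /=.
    by rewrite -scalerAl newton_shift scalerDr scalerA [a l * _]mulrC.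
  have -> : newton_sum n b
     = \sum_(0 <= l < n.+1) (if l is l'.+1 then a l' else 0) *: newton n l
     + \sum_(0 <= l < n.+1)
         ((l%:R + m%:R) * (n%:R - l%:R + m%:R) * a l) *: newton n l.
    by rewrite -big_split; apply: eq_bigr => l _ /=; rewrite scalerDl.
  rewrite big_nat_recr //= [X in _ = X + _ + _]big_nat_recl //= scale0r add0r.
  by rewrite addrAC.
rewrite -[X in eqjet _ _ X]addr0 -(scaler0 _ (a n)).
by apply: eqjetD; [apply: eqjet_refl | apply/eqjetZ/newton_eqjet0].
Qed.

(** At a node z = k, the Newton sum with these coefficients is the balanced series 3F2(-k, k - n, E
    - C; -n - C, E + 1; 1) of the Pfaff-Saalschutz theorem. *)
Definition ncoef (n C E l : nat) : rat :=
  \prod_(i < l) ((C%:R - E%:R - i%:R)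
     / (i.+1%:R * (n%:R + C%:R - i%:R) * (E%:R + i.+1%:R))).

Lemma ncoefS n C E l :
  ncoef n C E l.+1 = ncoef n C E l * ((C%:R - E%:R - l%:R)
     / (l.+1%:R * (n%:R + C%:R - l%:R) * (E%:R + l.+1%:R))).
Proof. by rewrite /ncoef big_ord_recr. Qed.

Lemma ncoef0 n C E : ncoef n C E 0 = 1.
Proof. by rewrite /ncoef big_ord0. Qed.

Lemma natrBD_neq0 (n C l : nat) : (l < n)%N -> n%:R + C%:R - l%:R != 0 :> rat.
Proof.
move=> ltln; rewrite -natrD -natrB; last first.
  exact: leq_trans (ltnW ltln) (leq_addr _ _).
by rewrite pnatr_eq0 -lt0n subn_gt0 (leq_trans ltln) ?leq_addr.
Qed.

(** Raising C shifts the two products containing C by one place, so only their new leading factors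
    appear. This puts all terms of the recurrence in C over the common factor [ncoef n C E l];
    [ncoef_upE] does the same for E. *)
Lemma ncoef_upC n C E l : (l < n)%N ->
  ncoef n C.+1 E l.+1 = ncoef n C E l * ((C.+1%:R - E%:R)
     / (l.+1%:R * (n%:R + C.+1%:R) * (E%:R + l.+1%:R))).
Proof.
elim: l => [|l IHl] ltln; first by rewrite ncoefS !ncoef0 !subr0.
rewrite ncoefS IHl ?(ltnW ltln) // ncoefS.
have h1 := natrBD_neq0 n C l (ltnW ltln); have h2 := natrDS_neq0 n C.
have h3 := natrDS_neq0 E l; have h4 := natrDS_neq0 E l.+1.
have h5 := natrDS_neq0 0 l; have h6 := natrDS_neq0 0 l.+1.
rewrite ?add0r -!natr1 ?add0r ?addrA in h1 h2 h3 h4 h5 h6 *.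
by field; rewrite h1 h2 h3 h4 h5 h6.
Qed.

Lemma ncoef_upE n C E l : (l < n)%N ->
  ncoef n C E l.+1 = ncoef n C E.+1 l * ((C%:R - E%:R)
     / (l.+1%:R * (n%:R + C%:R - l%:R) * E.+1%:R)).
Proof.
elim: l => [|l IHl] ltln.
  by rewrite ncoefS !ncoef0 !subr0; congr (_ * (_ / _)); rewrite -natr1; ring.
rewrite ncoefS IHl ?(ltnW ltln) // ncoefS.
have h1 := natrBD_neq0 n C l (ltnW ltln); have h2 := natrBD_neq0 n C l.+1 ltln.
have h3 := natrDS_neq0 E.+1 l; have h4 := natrDS_neq0 0 E.
have h5 := natrDS_neq0 0 l; have h6 := natrDS_neq0 0 l.+1.
rewrite ?add0r -!natr1 ?add0r ?addrA in h1 h2 h3 h4 h5 h6 *.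
by field; rewrite h1 h2 h3 h4 h5 h6.
Qed.

Lemma eqjet_newton_sumS n m a b :
  (forall l, (l <= n)%N ->
     m.+1%:R * (n%:R + m.+1%:R) * b l
     = (if l is l'.+1 then a l' else 0)
       + (l%:R + m.+1%:R) * (n%:R - l%:R + m.+1%:R) * a l) ->
  eqjet n ((m.+1%:R * (n%:R + m.+1%:R))^-1
             *: (newton_sum n a * (('X + m.+1%:R) * (n%:R + m.+1%:R - 'X))))
    (newton_sum n b).
Proof.
move=> ab.
apply: (eqjet_trans _ _ _ _ (eqjetZ _ _ _ _ (newton_sum_shift n m.+1 a))).
rewrite /newton_sum scaler_sumr.
rewrite (_ : \sum_(0 <= l < _) _ = \sum_(0 <= l < n.+1) b l *: newton n l) //.
rewrite !big_nat; apply: eq_bigr => l lel.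
rewrite -ab // !scalerA mulKf // mulf_neq0 ?natrDS_neq0 //.
by rewrite pnatr_eq0.
Qed.

(** E is raised first, at C = 0, then C. Raising C multiplies the Newton sum by the new factor of
    [beta n C]. Raising E works backwards: the new factor of [beta n E.+1] times the Newton sum for
    E + 1 gives back the one for E. *)
Lemma beta_eqjet n C E :
  eqjet n (beta n C) (beta n E * newton_sum n (ncoef n C E)).
Proof.
elim: C => [|C IHC].
  elim: E => [|E IHE].
    (* For C = E = 0 the factor C - E - 0 kills every coefficient but the one at l = 0. *)
    rewrite /newton_sum big_nat_recl // big1 => [|l _].
      rewrite /beta /newton !big_ord0 ncoef0 addr0 scale1r mulr1.
      exact: eqjet_refl.
    by rewrite /ncoef big_ord_recl /= !subr0 !mul0r scale0r.
  apply: (eqjet_trans _ _ _ _ IHE).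
  rewrite betaS -scalerAl -mulrA scalerAr.
  rewrite [_ * newton_sum _ (ncoef _ _ E.+1)]mulrC.
  apply/eqjetM/eqjet_sym/eqjet_newton_sumS => -[|l] lel.
    by rewrite !ncoef0; ring.
  rewrite ncoef_upE // ncoefS.
  have h1 := natrBD_neq0 n 0 l lel.
  have h3 := natrDS_neq0 E.+1 l.
  have h5 := natrDS_neq0 0 l; have h7 := natrDS_neq0 0 E.
  rewrite !(add0r, addr0) -!natr1 ?addrA in h1 h3 h5 h7 *.
  by field; rewrite h1 h3 h5 h7.
rewrite betaS [beta n C * _]mulrC.
apply: (eqjet_trans _ _ _ _ (eqjetZ _ _ _ _ (eqjetM _ _ _ _ IHC))).
rewrite [_ * (beta n E * _)]mulrC -mulrA scalerAr.
apply/eqjetM/eqjet_newton_sumS => -[|l] lel; first by rewrite !ncoef0; ring.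
rewrite ncoef_upC // ncoefS.
have h1 := natrBD_neq0 n C l lel; have h2 := natrDS_neq0 n C.
have h3 := natrDS_neq0 E l; have h5 := natrDS_neq0 0 l.
rewrite !(add0r, addr0) -!natr1 ?addrA in h1 h2 h3 h5 *.
by field; rewrite h1 h2 h3 h5.
Qed.

(** * Binomials with integer upper argument, and assembly of the identity *)

Lemma binz0 m : binz m 0 = 1.
Proof. by rewrite /binz big_ord0 fact0 divr1. Qed.

Lemma binzS m l : binz m l.+1 = binz m l * (m%:~R - l%:R) / l.+1%:R.
Proof.
rewrite /binz big_ord_recr /= factS natrM.
have h : l`!%:R != 0 :> rat by rewrite pnatr_eq0 -lt0n fact_gt0.
have h' := natrDS_neq0 0 l; rewrite -natr1 add0r in h' *.
by field; rewrite h h'.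
Qed.

Lemma ncoefE n C E l : (l <= n)%N ->
  ncoef n C E l = binz (C%:Z - E%:Z) l
    / (l`!%:R ^+ 2 * 'C(n + C, l)%:R * 'C(l + E, l)%:R).
Proof.
elim: l => [|l IHl] lel.
  by rewrite ncoef0 binz0 fact0 !bin0.
rewrite ncoefS IHl ?(ltnW lel) // binzS natr_binS natr_binSl factS natrM.
rewrite rmorphB /= !natrD.
have h1 := natrBD_neq0 n C l lel.
have h9 := natrDS_neq0 l E; have h5 := natrDS_neq0 0 l.
have h6 := natr_bin_neq0 l E.
have h7 : 'C(n + C, l)%:R != 0 :> rat.
  by rewrite pnatr_eq0 -lt0n bin_gt0 (leq_trans (ltnW lel)) ?leq_addr.
have h8 : l`!%:R != 0 :> rat by rewrite pnatr_eq0 -lt0n fact_gt0.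
rewrite !(add0r, addr0) -!natr1 ?natrD ?addrA in h1 h5 h9 *.
by field; rewrite h1 h5 h6 h7 h8 h9.
Qed.

Lemma beta_sym n B k : (k <= n)%N ->
  (beta n B).[(n - k)%:R] = (beta n B).[k%:R].
Proof.
move=> lekn; rewrite /beta !horner_prod; apply: eq_bigr => j _.
by rewrite !(hornerE, hornerMn) natrB //=; ring.
Qed.

Lemma dsum_logderiv n (p : {poly rat}) (g : nat -> rat) :
  (forall k, (k <= n)%N -> p.[(n - k)%:R] = p.[k%:R]) ->
  (forall k, (k <= n)%N -> p^`().[k%:R] = p.[k%:R] * (g (n - k)%N - g k)) ->
  \sum_(0 <= k < n.+1) p.[k%:R] * (1 + (n%:R - 2 * k%:R) * g k) = dsum n p.
Proof.
move=> psym pder.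
pose h k := (k%:R - n%:R / 2) * (p.[k%:R] * g k).
have hrev : \sum_(0 <= k < n.+1) h k
    = - \sum_(0 <= k < n.+1) (k%:R - n%:R / 2) * (p.[k%:R] * g (n - k)%N).
  rewrite big_nat_rev /= add0n -sumrN !big_nat; apply: eq_bigr => k lek.
  by rewrite /h subSS psym // natrB //; field.
transitivity (\sum_(0 <= k < n.+1) p.[k%:R] - 2 * \sum_(0 <= k < n.+1) h k).
  rewrite mulr_sumr -sumrB; apply: eq_bigr => k _; by rewrite /h; field.
(* Only one of the two copies of the sum of [h] is reversed, which produces the difference of g(n -
   k) and g(k). *)
rewrite mulr_natl mulr2n {1}hrev opprD opprK addrA /dsum.
rewrite -sumrN -!big_split /= !big_nat; apply: eq_bigr => k lek.
rewrite derivM !derivE !hornerE pder // /h /=; ring.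
Qed.

(** The multiples of n become independent parameters, as in the inductions above, which raise them
    one at a time with n fixed. *)
Lemma harmonic_sum_eq (n B C D E : nat) :
  \sum_(0 <= k < n.+1)
     'C(n, k)%:R ^+ 2
     * (('C(k + B, k)%:R * 'C(k + C, k)%:R
         * 'C(k + D, k)%:R * 'C(n + E, k)%:R)
        / ('C(n + B, k)%:R * 'C(n + C, k)%:R
           * 'C(n + D, k)%:R * 'C(k + E, k)%:R))
     * (1 + (n%:R - 2 * k%:R)
            * (2 * harmonic k - harmonic (B + k) - harmonic (C + k)
               - harmonic (D + k) + harmonic (E + k)))
  = 'C(1 + B + D + n, n)%:R
      / ('C(n + B, n)%:R * 'C(n + D, n)%:R)
    * \sum_(0 <= l < n.+1)
        (-1) ^+ l * 'C(n, l)%:R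
        * (('C(l + B, l)%:R * 'C(l + D, l)%:R
            * binz (C%:Z - E%:Z) l)
           / ('C(n + C, l)%:R * 'C(l + E, l)%:R
              * 'C(1 + B + D + l, l)%:R))
  :> rat.
Proof.
set H := newton_sum n (ncoef n C E).
(* [H] agrees to first order with the quotient of [beta n C] by [beta n E] at the nodes, so the
   polynomial [p] can stand for the rational function f. *)
pose p := H * (beta n B * beta n D).
pose g k := 2 * harmonic k - harmonic (B + k) - harmonic (C + k)
               - harmonic (D + k) + harmonic (E + k).
have bpos A k : (k <= n)%N -> (beta n A).[k%:R] != 0.
  move=> lek; rewrite beta_horner // !mulf_neq0 ?invr_eq0 ?natr_bin_neq0 //.
    by rewrite pnatr_eq0 -lt0n bin_gt0.
  by rewrite pnatr_eq0 -lt0n bin_gt0 (leq_trans lek) ?leq_addr.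
have HE k : (k <= n)%N -> H.[k%:R] = (beta n C).[k%:R] / (beta n E).[k%:R].
  move=> lek; apply: canRL (mulfK (bpos _ _ lek)) _.
  by have [-> _] := beta_eqjet n C E k lek; rewrite hornerM mulrC.
have H'E k : (k <= n)%N -> H^`().[k%:R]
   = ((beta n C)^`().[k%:R] - (beta n E)^`().[k%:R] * H.[k%:R])
     / (beta n E).[k%:R].
  move=> lek; apply: canRL (mulfK (bpos _ _ lek)) _.
  have [_ ->] := beta_eqjet n C E k lek.
  by rewrite derivM hornerD !hornerM -/H; ring.
transitivity (dsum n p).
  rewrite -(dsum_logderiv n p g) => [|k lek|k lek].
  - rewrite !big_nat; apply: eq_bigr => k; rewrite /= ltnS => lek.
    rewrite /g; congr (_ * _).
    rewrite /p !hornerM HE // !beta_horner //.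
    have nz A : 'C(n + A, k)%:R != 0 :> rat.
      by rewrite pnatr_eq0 -lt0n bin_gt0 (leq_trans lek) ?leq_addr.
    have := natr_bin_neq0 k E; have := nz 0%N; rewrite addn0 => h1 h2.
    by field; rewrite h1 h2 !nz.
  - by rewrite /p !hornerM !HE ?leq_subr // !beta_sym.
  - rewrite /p !derivM !(hornerD, hornerM).
    rewrite H'E // HE // !beta_deriv // /g.
    by field; rewrite bpos.
(* Expanding [H] in Newton polynomials makes the two sides agree term by term. *)
rewrite /p /H /newton_sum mulr_suml dsum_sum mulr_sumr !big_nat.
apply: eq_bigr => l; rewrite /= ltnS => lel.
rewrite -scalerAl dsumZ dsum_newton_beta /dsum_value ncoefE //.
rewrite -[(1 + B + D)%N]/(B + D).+1 ![((B + D).+1 + _)%N]addnC.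
have h6 := natr_bin_neq0 l E; have h1 := natr_bin_neq0 n B.
have h2 := natr_bin_neq0 n D; have h3 := natr_bin_neq0 l (B + D).+1.
have h7 : 'C(n + C, l)%:R != 0 :> rat.
  by rewrite pnatr_eq0 -lt0n bin_gt0 (leq_trans lel) ?leq_addr.
have h8 : l`!%:R != 0 :> rat by rewrite pnatr_eq0 -lt0n fact_gt0.
by field; rewrite h1 h2 h3 h6 h7 h8.
Qed.

Theorem theorem9 (n b c d e : nat) :
  \sum_(0 <= k < n.+1)
     'C(n, k)%:R ^+ 2
     * (('C(k + b * n, k)%:R * 'C(k + c * n, k)%:R
         * 'C(k + d * n, k)%:R * 'C(n + e * n, k)%:R)
        / ('C(n + b * n, k)%:R * 'C(n + c * n, k)%:R
           * 'C(n + d * n, k)%:R * 'C(k + e * n, k)%:R))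
     * (1 + (n%:R - 2 * k%:R)
            * (2 * harmonic k - harmonic (b * n + k) - harmonic (c * n + k)
               - harmonic (d * n + k) + harmonic (e * n + k)))
  = 'C(1 + b * n + d * n + n, n)%:R
      / ('C(n + b * n, n)%:R * 'C(n + d * n, n)%:R)
    * \sum_(0 <= l < n.+1)
        (-1) ^+ l * 'C(n, l)%:R
        * (('C(l + b * n, l)%:R * 'C(l + d * n, l)%:R
            * binz ((c * n)%:Z - (e * n)%:Z) l)
           / ('C(n + c * n, l)%:R * 'C(l + e * n, l)%:R
              * 'C(1 + b * n + d * n + l, l)%:R))
  :> rat.
Proof. exact: harmonic_sum_eq. Qed.
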